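(* There exists a deterministic one-pass streaming algorithm that takes a stream of $\delta$-fat hyperrectangles in $[0,1]^d$ as input, and outputs $\hat V$ such that $V-\epsilon \le \hat V \le V$, using $O\left(\frac{2^{d^2+d}}{\epsilon^{d-1}\delta^d}\right)$ space, where $V$ is the Klee's measure of the stream and $\epsilon \in (0,1)$ is an input parameter.
   Context: Hyperrectangles are axis-parallel. The Klee's measure of a stream $R_1,\ldots,R_n$ of hyperrectangles is the volume $V$ of $\bigcup_{i=1}^n R_i$. A hyperrectangle $R \subset [0,1]^d$ is $\delta$-fat if the length of each of its sides is at least $\delta \in (0,1)$. A one-pass (insertion-only) streaming algorithm reads the items once in order and keeps only a sketch in memory. Space is counted in words, where a word can hold a point of $\mathbb{R}^d$, any input parameter, and a $\lceil \log n\rceil$-bit counter ($n$ is the stream length). *)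

(* Defs.v *)
From HB Require Import structures.
From mathcomp Require Import all_boot all_order all_algebra.
From mathcomp Require Import all_classical all_reals all_analysis.
Set Implicit Arguments.
Unset Strict Implicit.
Unset Printing Implicit Defensive.
Import Order.TTheory GRing.Theory Num.Theory.
Import numFieldNormedType.Exports.

Local Open Scope classical_set_scope.
Local Open Scope ring_scope.

(* MathComp-Analysis has Lebesgue measure on the line and binary products; the
   measure on R^d is iterated along the bijection R * R^d -> R^(d+1). *)
Section lebesgue_on_tuples.
Context (R : realType).

Definition consR (d : nat)
    (x : measurableTypeR R * d.-tuple (measurableTypeR R)) :
    d.+1.-tuple (measurableTypeR R) :=
  [tuple of x.1 :: x.2].

Lemma measurable_consR d : measurable_fun setT (@consR d).
Proof. exact: measurable_cons. Qed.

Section step.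
Context (d : nat)
  (mu : {sigma_finite_measure set (d.-tuple (measurableTypeR R)) -> \bar R}).

Definition lebesgue_cons :
    set (d.+1.-tuple (measurableTypeR R)) -> \bar R :=
  pushforward (@lebesgue_measure R \x mu)%E (@consR d).

Let lebesgue_cons0 : lebesgue_cons set0 = 0%E.
Proof. by rewrite /lebesgue_cons /pushforward preimage_set0 measure0. Qed.

Let lebesgue_cons_ge0 A : (0 <= lebesgue_cons A)%E.
Proof. by rewrite /lebesgue_cons /pushforward; exact: measure_ge0. Qed.

Let lebesgue_cons_sigma_additive : semi_sigma_additive lebesgue_cons.
Proof.
move=> F mF tF mUF; rewrite /lebesgue_cons /pushforward preimage_bigcup.
apply: measure_semi_sigma_additive.
- by move=> n; rewrite -[X in measurable X]setTI; exact: measurable_consR.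
- apply/trivIsetP => /= i j _ _ ij; rewrite -preimage_setI.
  by move/trivIsetP : tF => /(_ _ _ I I ij) ->; rewrite preimage_set0.
- rewrite -preimage_bigcup -[X in measurable X]setTI.
  exact: measurable_consR.
Qed.

HB.instance Definition _ := isMeasure.Build _ _ _ lebesgue_cons
  lebesgue_cons0 lebesgue_cons_ge0 lebesgue_cons_sigma_additive.

Let lebesgue_cons_sigma_finite : sigma_finite setT lebesgue_cons.
Proof.
have /sigma_finiteP[F [FT ndF Fm]] := sigma_finiteT (@lebesgue_measure R).
have /sigma_finiteP[G [GT ndG Gm]] := sigma_finiteT mu.
pose T := measurableTypeR R.
pose hd (t : d.+1.-tuple T) : T := thead t.
pose tl (t : d.+1.-tuple T) : d.-tuple T := [tuple of behead t].
have mhd : measurable_fun setT hd by exact: measurable_tnth.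
have mtl : measurable_fun setT tl by exact: measurable_behead.
have tlK x t : tl (consR (x, t)) = t by exact: val_inj.
exists (fun n => hd @^-1` F n `&` tl @^-1` G n).
  apply/esym; rewrite -subTset => t _.
  have [n _ Fn] : (\bigcup_n F n) (hd t) by rewrite -FT.
  have [m _ Gm'] : (\bigcup_n G n) (tl t) by rewrite -GT.
  exists (maxn n m) => //; split.
    by have /subsetPset := ndF _ _ (leq_maxl n m); exact.
  by have /subsetPset := ndG _ _ (leq_maxr n m); exact.
move=> n; have [mF Foo] := Fm n; have [mG Goo] := Gm n; split.
  apply: measurableI; rewrite -[X in measurable X]setTI; first exact: mhd.
  exact: mtl.
rewrite /lebesgue_cons /pushforward (_ : _ @^-1` _ = F n `*` G n); last first.
  by apply/seteqP; split=> -[x t] /=; rewrite tlK.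
by rewrite product_measure1E// lte_mul_pinfty// ge0_fin_numE.
Qed.

HB.instance Definition _ :=
  Measure_isSigmaFinite.Build _ _ _ lebesgue_cons lebesgue_cons_sigma_finite.

End step.

Definition lebesgue0 : set (0.-tuple (measurableTypeR R)) -> \bar R :=
  \d_ [tuple].
HB.instance Definition _ := SigmaFiniteMeasure.on lebesgue0.

Fixpoint lebesgue_tuple (d : nat) :
    {sigma_finite_measure set (d.-tuple (measurableTypeR R)) -> \bar R} :=
  if d is d'.+1 then lebesgue_cons (lebesgue_tuple d') else lebesgue0.

End lebesgue_on_tuples.

Record hyperrect (R : realType) (d : nat) :=
  Hyperrect { low : 'I_d -> R ; high : 'I_d -> R }.

Section klee.
Context (R : realType) (d : nat).
Implicit Types (r : hyperrect R d) (s : seq (hyperrect R d)).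

Definition hyperrect_set r : set (d.-tuple (measurableTypeR R)) :=
  [set x | forall i, low r i <= (tnth x i : R) <= high r i].

Definition klee_measure s : \bar R :=
  lebesgue_tuple R d (\big[setU/set0]_(r <- s) hyperrect_set r).

Definition fat_in_unit_cube (delta : R) r : Prop :=
  forall i, [/\ 0 <= low r i, high r i <= 1 & delta <= high r i - low r i].

End klee.

Lemma measurable_hyperrect_set (R : realType) (d : nat) (r : hyperrect R d) :
  measurable (hyperrect_set r).
Proof.
rewrite (_ : hyperrect_set r = \bigcap_(i in [set: 'I_d])
    ((fun x : d.-tuple (measurableTypeR R) => tnth x i) @^-1`
     `[low r i, high r i])).
  apply: fin_bigcap_measurable => [|i _]; first exact: finite_finset.
  rewrite -[X in measurable X]setTI.
  by apply: measurable_tnth => //; exact: measurable_itv.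
apply/seteqP; split=> [x xr i _|x xr i]; first by rewrite /= in_itv; exact: xr.
by have := xr i Logic.I; rewrite /= in_itv.
Qed.

Lemma lebesgue_tuple_hyperrect (R : realType) (d : nat) (r : hyperrect R d) :
  (forall i, low r i <= high r i) ->
  lebesgue_tuple R d (hyperrect_set r) =
  (\prod_(i < d) (high r i - low r i))%:E.
Proof.
elim: d r => [|d IHd] r lehi.
  rewrite big_ord0 /= /lebesgue0 diracE mem_set// => -[].
  by case.
pose r' := Hyperrect (fun i => low r (lift ord0 i))
                     (fun i => high r (lift ord0 i)).
rewrite /= /lebesgue_cons /pushforward.
rewrite (_ : _ @^-1` _ = `[low r ord0, high r ord0] `*` hyperrect_set r').
  rewrite product_measure1E//; last exact: measurable_hyperrect_set.
  rewrite [X in (_ * X)%E = _]IHd//; last by move=> i; exact: lehi.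
  rewrite /= lebesgue_measure_itv/= lte_fin big_ord_recl EFinM.
  case: ltP => // hile; rewrite (_ : high r ord0 - low r ord0 = 0)//.
  by apply/eqP; rewrite subr_eq0 eq_le hile lehi.
apply/seteqP; split=> -[x t] /=.
  move=> xt; split=> /=; first by have := xt ord0; rewrite tnth0 in_itv.
  by move=> i; have := xt (lift ord0 i); rewrite tnthS.
move=> [/= xr tr] i; case: (unliftP ord0 i) => [j|] ->.
  by rewrite tnthS; exact: tr.
by rewrite tnth0; move: xr; rewrite in_itv.
Qed.

(* The model of computation.

   A sketch consists of words of two kinds, points of R^d and counters.  Were a
   point word allowed to hold the result of arbitrary arithmetic, a single word
   could encode an unbounded amount of data and counting words would be
   meaningless.  Point words are therefore indivisible: each coordinate written
   into the sketch is a copy of a coordinate of the current hyperrectangle, of a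
   coordinate already in the sketch, of an input parameter, or of 0 or 1.
   Arithmetic is free in the tests that govern the updates and in the final
   answer, whose evaluation leaves no trace in the sketch. *)

Inductive term (X : Type) :=
  | Var of X
  | Nat of nat
  | Add of term X & term X
  | Sub of term X & term X
  | Mul of term X & term X
  | Div of term X & term X
  | IfLe of term X & term X & term X & term X.

Inductive decision_tree (X A : Type) :=
  | Leaf of A
  | TestLe of term X & term X & decision_tree X A & decision_tree X A.

Arguments Nat {X}.
Arguments Leaf {X A}.

Fixpoint eval (R : realType) (X : Type) (env : X -> R) (t : term X) : R :=
  match t with
  | Var x => env x
  | Nat n => n%:R
  | Add t1 t2 => eval env t1 + eval env t2
  | Sub t1 t2 => eval env t1 - eval env t2
  | Mul t1 t2 => eval env t1 * eval env t2
  | Div t1 t2 => eval env t1 / eval env t2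
  | IfLe t1 t2 t3 t4 =>
      if eval env t1 <= eval env t2 then eval env t3 else eval env t4
  end.

Fixpoint decide (R : realType) (X A : Type) (env : X -> R)
    (t : decision_tree X A) : A :=
  match t with
  | Leaf a => a
  | TestLe t1 t2 t3 t4 =>
      if eval env t1 <= eval env t2 then decide env t3 else decide env t4
  end.

(* Below, d is the dimension, p the number of point words and k the number of
   counter words. *)

Inductive sketch_var (d p k : nat) :=
  | DeltaVar
  | EpsVar
  | PointVar of 'I_p & 'I_d
  | CounterVar of 'I_k.

Inductive update_var (d p k : nat) :=
  | SketchVar of sketch_var d p k
  | LowVar of 'I_d
  | HighVar of 'I_d.

Arguments DeltaVar {d p k}.
Arguments EpsVar {d p k}.
Arguments PointVar {d p k}.
Arguments CounterVar {d p k}.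
Arguments SketchVar {d p k}.
Arguments LowVar {d p k}.
Arguments HighVar {d p k}.

Inductive initial_coord := Init0 | Init1 | InitDelta | InitEps.

Inductive coord_source (d p : nat) :=
  | FromInitial of initial_coord
  | FromPoint of 'I_p & 'I_d
  | FromLow of 'I_d
  | FromHigh of 'I_d.

Inductive counter_source (k : nat) :=
  | Reset
  | CopyCounter of 'I_k
  | IncrCounter of 'I_k.

Arguments FromInitial {d p}.
Arguments FromPoint {d p}.
Arguments FromLow {d p}.
Arguments FromHigh {d p}.
Arguments Reset {k}.
Arguments CopyCounter {k}.
Arguments IncrCounter {k}.

Record sketch (R : realType) (d p k : nat) := Sketch {
  point_word : 'I_p -> 'I_d -> R ;
  counter_word : 'I_k -> nat }.

(* An algorithm for fixed values of the input parameters.  All the words of the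
   sketch are updated simultaneously, each according to a finite decision tree
   that reads the current sketch, hyperrectangle and parameters.  The stream
   length is not available to the algorithm. *)
Record algorithm (d : nat) := Algorithm {
  npoints : nat ;
  ncounters : nat ;
  initial_point : 'I_npoints -> 'I_d -> initial_coord ;
  update_point : 'I_npoints ->
    decision_tree (update_var d npoints ncounters)
                  ('I_d -> coord_source d npoints) ;
  update_counter : 'I_ncounters ->
    decision_tree (update_var d npoints ncounters) (counter_source ncounters) ;
  output : term (sketch_var d npoints ncounters) }.

(* Three further words hold the input parameters d, delta and eps. *)
Definition space_in_words (d : nat) (A : algorithm d) : nat :=
  (npoints A + ncounters A + 3)%N.

Section execution.
Context (R : realType) (d : nat) (A : algorithm d) (delta eps : R).
Local Notation sketchA := (sketch R d (npoints A) (ncounters A)).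
Implicit Types (m : sketchA) (r : hyperrect R d) (s : seq (hyperrect R d)).

Definition sketch_env m (x : sketch_var d (npoints A) (ncounters A)) : R :=
  match x with
  | DeltaVar => delta
  | EpsVar => eps
  | PointVar j i => point_word m j i
  | CounterVar j => (counter_word m j)%:R
  end.

Definition update_env m r (x : update_var d (npoints A) (ncounters A)) : R :=
  match x with
  | SketchVar y => sketch_env m y
  | LowVar i => low r i
  | HighVar i => high r i
  end.

Definition initial_value (c : initial_coord) : R :=
  match c with
  | Init0 => 0
  | Init1 => 1
  | InitDelta => delta
  | InitEps => eps
  end.

Definition coord_value m r (c : coord_source d (npoints A)) : R :=
  match c with
  | FromInitial c0 => initial_value c0
  | FromPoint j i => point_word m j i
  | FromLow i => low r i
  | FromHigh i => high r i
  end.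

Definition counter_value m (c : counter_source (ncounters A)) : nat :=
  match c with
  | Reset => 0%N
  | CopyCounter j => counter_word m j
  | IncrCounter j => (counter_word m j).+1
  end.

Definition initial_sketch : sketchA :=
  Sketch (fun j i => initial_value (initial_point j i)) (fun=> 0%N).

Definition step m r : sketchA :=
  Sketch
    (fun j i => coord_value m r (decide (update_env m r) (update_point j) i))
    (fun j => counter_value m (decide (update_env m r) (update_counter j))).

Definition run s : sketchA := foldl step initial_sketch s.

Definition answer s : R := eval (sketch_env (run s)) (output A).

(* At every moment each counter fits into ceil(log2 n) bits, where n is the
   length of the whole stream. *)
Definition counters_fit s : Prop :=
  forall (t : nat) (j : 'I_(ncounters A)), (t <= size s)%N ->
    (counter_word (run (take t s)) j < 2 ^ up_log 2 (size s))%N.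

End execution.

(* Main.v *)
Require Import Defs.
From HB Require Import structures.
From mathcomp Require Import all_boot all_order all_algebra.
From mathcomp Require Import all_classical all_reals all_analysis.
From mathcomp Require Import measurable_realfun lra zify.
Set Implicit Arguments.
Unset Strict Implicit.
Unset Printing Implicit Defensive.
Import Order.TTheory GRing.Theory Num.Theory.
Local Open Scope classical_set_scope.
Local Open Scope ring_scope.

(* Cut the unit interval into M <= 2/delta blocks of length at most delta, each
   block into k cells, and put N = M k.  The first d - 1 coordinates are rounded
   to the N^(d-1) columns of the cell grid and the last one is kept exactly: for
   every column, consider the rectangles whose projection contains the whole
   column.  Inside a block, a delta-fat interval reaches one of the two ends of
   the block, so the union of the last sides of these rectangles is determined
   there by the highest point reached from below and the lowest point reached
   from above.  These 2 M N^(d-1) numbers are coordinates of the input, and they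
   are all that is stored.

   The volume V' of the resulting union is at most V.  Rounding one coordinate
   loses volume at most 2/k: along a line in that direction, again because each
   interval reaches an end of the block, the points that are covered by an
   interval but whose cell lies in no interval belong to at most two intervals
   of length 1/N per block.  Fubini turns this into a bound on the volume, and
   rounding the d - 1 coordinates one after the other (induction on the
   dimension) gives V - V' <= 2 (d - 1)/k <= eps with k <= 2^d/eps. *)

(** * Running extrema and the cell grid *)

Definition running_max (R : realType) (T : Type) (P : pred T) (f : T -> R)
    (m0 : R) (s : seq T) : R :=
  foldl (fun m r => if P r && (m <= f r) then f r else m) m0 s.

Definition running_min (R : realType) (T : Type) (P : pred T) (f : T -> R)
    (m0 : R) (s : seq T) : R :=
  foldl (fun m r => if P r && (f r <= m) then f r else m) m0 s.

(** Later estimates use the extrema only through thresholds, which treats the initial value [m0] and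
    the values of the stream alike. *)
Lemma le_running_max (R : realType) (T : Type) (P : pred T) (f : T -> R)
    (m0 : R) (s : seq T) (x : R) :
  (x <= running_max P f m0 s) = (x <= m0) || has (fun r => P r && (x <= f r)) s.
Proof.
elim: s m0 => [|r s IHs] m0 /=; first by rewrite orbF.
rewrite /running_max /= -/(running_max _ _ _ _) IHs orbA; congr (_ || _).
case: (P r) => /=; last by rewrite orbF.
case: ifPn => [mf|]; last first.
  rewrite -ltNge => fm; apply/idP/orP => [->|[|/le_trans]]; [by left|by []|].
  by apply; exact: ltW.
by apply/idP/orP => [->|[/le_trans|]]; [right|exact|].
Qed.

Lemma ge_running_min (R : realType) (T : Type) (P : pred T) (f : T -> R)
    (m0 : R) (s : seq T) (x : R) :
  (running_min P f m0 s <= x) = (m0 <= x) || has (fun r => P r && (f r <= x)) s.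
Proof.
elim: s m0 => [|r s IHs] m0 /=; first by rewrite orbF.
rewrite /running_min /= -/(running_min _ _ _ _) IHs orbA; congr (_ || _).
case: (P r) => /=; last by rewrite orbF.
case: ifPn => [mf|]; last first.
  by rewrite -ltNge => fm; apply/idP/orP => [->|[//|]]; [left|exact/le_trans/ltW].
by apply/idP/orP => [->|[|//]]; [right|exact: le_trans].
Qed.

Section grid.
Context (R : realType).
Implicit Types (A : set (measurableTypeR R)) (M N : nat).
Notation lambda := (@lebesgue_measure R).

(** Open on the left, so that the cells tile []0, 1]] disjointly; the point 0 lies in none of them
    and is null. *)
Definition cell N (c : nat) : set (measurableTypeR R) :=
  [set` `](c%:R / N%:R : R), c.+1%:R / N%:R]].

Lemma measurable_cell N c : measurable (cell N c).
Proof. exact: measurable_itv. Qed.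

Lemma cell_itv N c (x : R) : (0 < N)%N ->
  cell N c x <-> c%:R < N%:R * x <= c.+1%:R.
Proof.
move=> N0; rewrite /cell /= in_itv/= ltr_pdivrMr ?ltr0n// ler_pdivlMr ?ltr0n//.
by rewrite [x * _]mulrC.
Qed.

Lemma cell_uniq N c c' (x : R) : (0 < N)%N ->
  cell N c x -> cell N c' x -> c = c'.
Proof.
move=> N0 /(cell_itv _ _ N0) /andP[cx xc] /(cell_itv _ _ N0)/andP[c'x xc'].
have := lt_le_trans cx xc'; have := lt_le_trans c'x xc.
by rewrite !ltr_nat !ltnS => c1 c2; apply/eqP; rewrite eqn_leq c1 c2.
Qed.

Lemma cell_exists N (x : R) : (0 < N)%N -> 0 < x <= 1 ->
  exists2 c, (c < N)%N & cell N c x.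
Proof.
move=> N0 /andP[x0 x1].
have Nx0 : 0 < N%:R * x by rewrite mulr_gt0// ltr0n.
have exc : exists n : nat, N%:R * x <= n%:R.
  by exists N; rewrite ler_piMr.
case: (ex_minnP exc) => -[|c] xc minc; first by move: xc; rewrite leNgt Nx0.
have cN : (c.+1 <= N)%N by apply: minc; rewrite ler_piMr.
exists c => //; apply/cell_itv => //; rewrite xc andbT ltNge; apply/negP => /minc.
by rewrite ltnn.
Qed.

Lemma measure_cell N c : (0 < N)%N -> lambda (cell N c) = (N%:R^-1)%:E.
Proof.
move=> N0; rewrite lebesgue_measure_itv /= lte_fin ltr_pM2r ?invr_gt0 ?ltr0n//.
rewrite ltr_nat ltnSn -EFinD; congr EFin.
by rewrite -mulrBl -natrB// subSnn mul1r.
Qed.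

Lemma measure_cells N A : (0 < N)%N -> measurable A -> A `<=` `[0, 1] ->
  (lambda A = \sum_(c < N) lambda (A `&` cell N c))%E.
Proof.
move=> N0 mA A01.
rewrite -measure_bigsetU_ord; first last.
- move=> i j _ _ [x [[_ xi] [_ xj]]]; exact/val_inj/(cell_uniq N0 xi xj).
- by move=> i; apply: measurableI => //; exact: measurable_cell.
rewrite -(bigcup_mkord N (fun c => A `&` cell N c)).
set B := \bigcup_(_ in _) _.
have mB : measurable B.
  apply: fin_bigcup_measurable => // i _; apply: measurableI => //.
  exact: measurable_cell.
have BA : B `<=` A by move=> x [c _ []].
have [A0|A0] := pselect (A 0); last first.
  congr (lambda _); apply/seteqP; split=> // x Ax.
  have /= := A01 _ Ax; rewrite in_itv/= le_eqVlt => /andP[/predU1P[x0|x0] x1].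
    by rewrite -x0 in Ax.
  have [|c cN cx] := @cell_exists N x N0; first by rewrite x0.
  by exists c.
have -> : A = B `|` [set 0].
  apply/seteqP; split=> [x Ax|x [/BA//|->//]].
  have /= := A01 _ Ax; rewrite in_itv/= le_eqVlt => /andP[/predU1P[x0|x0] x1].
    by right.
  have [|c cN cx] := @cell_exists N x N0; first by rewrite x0.
  by left; exists c.
by rewrite measureU0//; exact: lebesgue_measure_set1.
Qed.

(** Block ends are multiples of [k] on the fine grid, so a fine cell sharing a point with a block
    lies inside it. *)
Lemma cell_refine M k j c (x : R) : (0 < M)%N -> (0 < k)%N ->
  cell M j x -> cell (M * k) c x ->
  j%:R / M%:R <= c%:R / (M * k)%:R :> R /\
  c.+1%:R / (M * k)%:R <= j.+1%:R / M%:R :> R.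
Proof.
move=> M0 k0 /(cell_itv _ _ M0)/andP[jx xj] xc.
have Mk0 : (0 < M * k)%N by rewrite muln_gt0 M0.
move: xc => /(cell_itv _ _ Mk0)/andP[cx xc].
have kR0 : 0 < k%:R :> R by rewrite ltr0n.
have iE i : i%:R / M%:R = (i * k)%:R / (M * k)%:R :> R.
  by rewrite !natrM -mulf_div divff ?mulr1// gt_eqF.
rewrite !iE !ler_pM2r ?invr_gt0 ?ltr0n// !ler_nat.
have xE (y : R) : (M * k)%:R * y = M%:R * y * k%:R by rewrite natrM mulrAC.
have : j%:R * k%:R < (M * k)%:R * x by rewrite xE ltr_pM2r.
move=> /lt_le_trans /(_ xc); rewrite -natrM ltr_nat ltnS => jkc.
have : (M * k)%:R * x <= j.+1%:R * k%:R by rewrite xE ler_pM2r.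
move=> /(lt_le_trans cx); rewrite -natrM ltr_nat => cjk.
by split.
Qed.

End grid.

(** * Unions of intervals at least as long as a block *)

Section intervals.
Context (R : realType) (T : eqType) (s : seq T) (l h : T -> R) (M : nat).
Hypotheses (M_gt0 : (0 < M)%N)
  (fat : forall r, r \in s -> M%:R^-1 <= h r - l r).
Notation lambda := (@lebesgue_measure R).

(* If no interval qualifies, the initial values 0 and 1 remain; block_length
   clips them to the block. *)
Definition reach_up j : R :=
  running_max (fun r => l r <= j%:R / M%:R) h 0 s.
Definition reach_down j : R :=
  running_min (fun r => j.+1%:R / M%:R <= h r) l 1 s.

(** If the left end lies above the lower end of the block, a length of at least 1/M carries the
    right end past the upper end. *)
Let anchored j r (x : R) : r \in s -> cell M j x -> l r <= x <= h r ->
  (l r <= j%:R / M%:R) || (j.+1%:R / M%:R <= h r).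
Proof.
move=> rs; rewrite /cell/= in_itv/= => /andP[jx xj] /andP[lx xh].
case: leP => //= jl; have := fat rs.
rewrite [j.+1%:R]mulrSr [in X in _ -> X]mulrDl div1r; lra.
Qed.

(** In each block, the points of [E] lie within one cell length [w] below [U] or above [L];
    otherwise the interval reaching furthest would contain the whole cell of the point. *)
Lemma measure_straddling_cells k (E : set (measurableTypeR R)) :
  (0 < k)%N -> measurable E -> E `<=` `[0, 1] ->
  (forall x, E x -> has (fun r => l r <= x <= h r) s) ->
  (forall x c, (c < M * k)%N -> E x -> cell (M * k) c x ->
    ~~ has (fun r => (l r <= c%:R / (M * k)%:R) &&
                     (c.+1%:R / (M * k)%:R <= h r)) s) ->
  (lambda E <= (2 / k%:R)%:E)%E.
Proof.
move=> k0 mE E01 Es Ec.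
have Mk0 : (0 < M * k)%N by rewrite muln_gt0 M_gt0.
set w : R := (M * k)%:R^-1; have w0 : 0 < w by rewrite invr_gt0 ltr0n.
(* There are M blocks, and M * 2w = 2/k. *)
suff Ej j : (lambda (E `&` cell M j) <= (w + w)%:E)%E.
  rewrite (measure_cells M_gt0)//; apply: le_trans (lee_sum _ (fun _ _ => Ej _)) _.
  rewrite sumEFin lee_fin sumr_const card_ord -[leLHS]mulr_natl.
  have Mw : M%:R * w = k%:R^-1.
    by rewrite /w natrM invfM mulrA divff ?mul1r// gt_eqF ?ltr0n.
  by rewrite mulrDr Mw mulr_natl mulr2n.
set U := reach_up j; set L := reach_down j.
pose V : set (measurableTypeR R) := `[U - w, U] `|` `[L, L + w].
have /le_trans : (lambda (E `&` cell M j) <= lambda V)%E.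
  apply: le_measure; rewrite ?inE//.
  - by apply: measurableI => //; exact: measurable_cell.
  - by apply: measurableU; exact: measurable_itv.
  move=> x [Ex jx].
  have /= := E01 _ Ex; rewrite in_itv/= => /andP[x0 x1].
  have x_gt0 : 0 < x.
    move: jx; rewrite /cell/= in_itv/= => /andP[+ _]; apply: le_lt_trans.
    by rewrite divr_ge0.
  have [|c cN cx] := @cell_exists R _ x Mk0; first by rewrite x_gt0.
  have [jc cj] := cell_refine M_gt0 k0 jx cx.
  have /hasPn Nc := Ec _ _ cN Ex cx.
  have cE : c.+1%:R / (M * k)%:R = c%:R / (M * k)%:R + w.
    by rewrite mulrSr mulrDl div1r.
  have := cx; rewrite /cell/= in_itv/= => /andP[cx1 cx2].
  have /hasP[r rs /[dup] xr /andP[lx xh]] := Es _ Ex.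
  have /orP[lj|jh] := anchored rs jx xr; [left|right]; rewrite /= in_itv/=.
    have xU : x <= U.
      rewrite le_running_max; apply/orP; right.
      by apply/hasP; exists r => //; rewrite lj.
    rewrite xU andbT.
    (* An interval reaching the upper end of the cell would contain the cell; the initial value 0
       does not reach it, since that end is positive. *)
    have : U < c.+1%:R / (M * k)%:R.
      rewrite ltNge le_running_max leNgt divr_gt0 ?ltr0n//=.
      apply/hasPn => r' /Nc; apply: contra => /andP[l'j ->].
      by rewrite (le_trans l'j).
    by rewrite cE; lra.
  have xL : L <= x.
    rewrite ge_running_min; apply/orP; right.
    by apply/hasP; exists r => //; rewrite jh.
  rewrite xL/=.
  have : c%:R / (M * k)%:R < L.
    rewrite ltNge ge_running_min leNgt (lt_le_trans cx1)//=.
    apply/hasPn => r' /Nc; apply: contra => /andP[jh' ->].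
    by rewrite (le_trans cj).
  by move: cx2; rewrite cE; lra.
apply; apply: le_trans (measureU2 _ _ _) _; try exact: measurable_itv.
rewrite [in leLHS]/= !lebesgue_measure_itv/= !lte_fin.
rewrite gtrDl oppr_lt0 w0 ltrDl w0 -!EFinD lee_fin; lra.
Qed.

(* The intervals miss exactly the points of block j above u and below v. *)
Definition block_length (u v : R) j : R :=
  M%:R^-1 - Num.max 0
    (Num.min v (j.+1%:R / M%:R) - Num.max u (j%:R / M%:R)).

Hypothesis s01 : forall r, r \in s -> 0 <= l r /\ h r <= 1.

Lemma measurable_has_itv (p : pred T) :
  measurable ([set x | has (fun r => p r && (l r <= x <= h r)) s]
              : set (measurableTypeR R)).
Proof.
elim: s => [|r s' IHs].
  by rewrite (_ : mkset _ = set0)//; apply/seteqP; split.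
rewrite (_ : mkset _ = (if p r then `[l r, h r]%classic else set0) `|`
  [set x | has (fun r => p r && (l r <= x <= h r)) s']).
  by apply: measurableU => //; case: ifP => // _; exact: measurable_itv.
apply/seteqP; split=> x /=.
  by case: (p r) => /= [/orP[]|]; [left; rewrite /= in_itv|right|right].
move=> [|->]; last by rewrite orbT.
by case: (p r) => //=; rewrite in_itv/= => ->.
Qed.

(** By anchoring, the covered part of a block consists of a bottom piece up to [U] and a top piece
    from [L], so two numbers determine its length. *)
Lemma measure_has_itv :
  lambda [set x | has (fun r => l r <= x <= h r) s] =
  (\sum_(j < M) block_length (reach_up j) (reach_down j) j)%:E.
Proof.
set A := mkset _; have mA : measurable A by exact: (measurable_has_itv predT).
rewrite (measure_cells M_gt0)//; last first.
  move=> x /hasP[r /s01[l0 h1] /andP[lx xh]]; rewrite /= in_itv/=.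
  by rewrite (le_trans l0 lx) (le_trans xh h1).
rewrite -sumEFin; apply: eq_bigr => -[j /= jM] _.
set U := reach_up j; set L := reach_down j.
set lo : R := j%:R / M%:R; set hi : R := j.+1%:R / M%:R.
have lo0 : 0 <= lo by rewrite divr_ge0.
have hi1 : hi <= 1 by rewrite ler_pdivrMr ?ltr0n// mul1r ler_nat.
have lohi : lo < hi by rewrite ltr_pM2r ?invr_gt0 ?ltr0n// ltr_nat.
have mC := @measurable_cell R M j.
have gap : lambda (cell M j `\` A) =
    (Num.max 0 (Num.min L hi - Num.max U lo))%:E.
  have mI (i : interval R) : measurable ([set` i] : set (measurableTypeR R)).
    exact: measurable_itv.
  (* The right end of the gap may or may not be covered, so the uncovered part is squeezed between
     an open and a right-closed interval of equal length. *)
  have gapE b : lambda [set` Interval (BRight (Num.max U lo))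
                                     (BSide b (Num.min L hi))] =
      (Num.max 0 (Num.min L hi - Num.max U lo))%:E.
    rewrite lebesgue_measure_itv/= lte_fin -EFinD.
    case: (ltP (Num.max U lo) (Num.min L hi)) => lt; congr EFin.
      by rewrite [RHS]max_r ?subr_ge0 ?ltW.
    by rewrite [RHS]max_l ?subr_le0.
  apply/eqP; rewrite eq_le -{1}(gapE false) -{1}(gapE true).
  apply/andP; split; apply: le_measure; rewrite ?inE//;
    try by apply: measurableD.
    move=> x [jx NAx]; have := jx; rewrite /cell/= !in_itv/= -/lo -/hi.
    move=> /andP[lox xhi]; rewrite gt_max le_min lox xhi !andbT/=.
    apply/andP; split; first rewrite ltNge; first apply/negP.
      rewrite le_running_max leNgt (le_lt_trans lo0 lox)/= => /hasP[r rs /andP[lr xr]].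
      by apply: NAx; apply/hasP; exists r => //; rewrite (le_trans lr (ltW lox)).
    rewrite leNgt; apply/negP => Lx.
    (* Being below 1, [L] is not the initial value; the threshold [L] itself then yields an interval
       starting at or below it. *)
    have L1 : L < 1 by rewrite (lt_le_trans Lx)// (le_trans xhi).
    have := lexx L; rewrite {1}/L ge_running_min leNgt L1/= => /hasP[r rs /andP[hr rL]].
    apply: NAx; apply/hasP; exists r => //.
    by rewrite (le_trans rL (ltW Lx)) (le_trans xhi).
  move=> x; rewrite /= in_itv/= gt_max lt_min => /andP[/andP[Ux lox] /andP[xL xhi]].
  have jx : cell M j x by rewrite /cell/= in_itv/= -/lo -/hi lox ltW.
  split => // /hasP[r rs /[dup] xr /andP[lx xh]].
  have /orP[lj|jh] := anchored rs jx xr.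
    move: Ux; rewrite ltNge le_running_max => /negP; apply; apply/orP; right.
    by apply/hasP; exists r => //; rewrite lj.
  move: xL; rewrite ltNge ge_running_min => /negP; apply; apply/orP; right.
  by apply/hasP; exists r => //; rewrite jh.
have : (lambda (cell M j) = lambda (cell M j `\` A) + lambda (cell M j `&` A))%E.
  exact: measureDI.
rewrite measure_cell// gap setIC.
case: (lambda (A `&` cell M j)) => [y| |]// [Mj]; congr EFin.
by rewrite /block_length -/U -/L -/lo -/hi Mj addrAC subrr add0r.
Qed.

End intervals.

(** * Rounding one coordinate *)

(** Equality of rectangles is decided classically, to have membership in lists. *)
HB.instance Definition _ (R : realType) (d : nat) := gen_eqMixin (hyperrect R d).

Section rectangles.
Context (R : realType).
Notation lambda := (@lebesgue_measure R).
Notation mu := (lebesgue_tuple R).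

Definition rect_mem d (r : hyperrect R d) (x : d.-tuple (measurableTypeR R)) :=
  [forall i, low r i <= (tnth x i : R) <= high r i].

Definition rect_tail d (r : hyperrect R d.+1) : hyperrect R d :=
  Hyperrect (fun i => low r (lift ord0 i)) (fun i => high r (lift ord0 i)).

Lemma rect_mem_cons d (r : hyperrect R d.+1) (x : measurableTypeR R) z :
  rect_mem r (consR (x, z)) =
  (low r ord0 <= x <= high r ord0) && rect_mem (rect_tail r) z.
Proof.
apply/forallP/andP => [xz|[x0 /forallP zr] i].
  split; first by have := xz ord0; rewrite tnth0.
  by apply/forallP => i; have := xz (lift ord0 i); rewrite tnthS.
by case: (unliftP ord0 i) => [j|] ->; rewrite ?tnthS ?tnth0//; exact: zr.
Qed.

Definition covered d (s : seq (hyperrect R d)) :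
    set (d.-tuple (measurableTypeR R)) :=
  [set x | has (fun r => rect_mem r x) s].

Lemma coveredE d (s : seq (hyperrect R d)) :
  covered s = \big[setU/set0]_(r <- s) hyperrect_set r.
Proof.
elim: s => [|r s IHs]; first by rewrite big_nil; apply/seteqP; split.
rewrite big_cons -IHs; apply/seteqP; split=> x; rewrite /covered/=.
  by move=> /orP[/forallP|]; [left|right].
by move=> [xr|->]; rewrite ?orbT//; apply/orP; left; exact/forallP.
Qed.

Lemma measurable_covered d (s : seq (hyperrect R d)) : measurable (covered s).
Proof.
rewrite coveredE; apply: bigsetU_measurable => r _.
exact: measurable_hyperrect_set.
Qed.

Lemma fat_rect_tail d (delta : R) (r : hyperrect R d.+1) :
  fat_in_unit_cube delta r -> fat_in_unit_cube delta (rect_tail r).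
Proof. by move=> rf i; exact: rf. Qed.

(** * Rounding the first coordinate *)

Section step.
Context (d : nat) (delta : R) (M k : nat) (s : seq (hyperrect R d.+1)).
Hypotheses (M_gt0 : (0 < M)%N) (k_gt0 : (0 < k)%N) (Mdelta : M%:R^-1 <= delta).
Hypothesis sfat : forall r, r \in s -> fat_in_unit_cube delta r.
Let N := (M * k)%N.

(** What rounding keeps over cell [c]: rectangles covering the cell only in part are dropped there,
    so no volume is added. *)
Definition slice n c : seq (hyperrect R d) :=
  [seq rect_tail r | r <- s & (low r ord0 <= c%:R / n%:R) &&
                              (c.+1%:R / n%:R <= high r ord0)].

(** [W] is the union in product coordinates, [P] below its rounded version, and their difference is
    what rounding loses. *)
Let W : set (measurableTypeR R * d.-tuple (measurableTypeR R)) :=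
  [set xz | has (fun r => (low r ord0 <= xz.1 <= high r ord0) &&
                          rect_mem (rect_tail r) xz.2) s].

Let WE : W = @consR R d @^-1` covered s.
Proof.
apply/funext => -[x z]; rewrite /W /covered /preimage /mkset.
by congr (is_true _); apply: eq_has => r; rewrite rect_mem_cons.
Qed.

Let mW : measurable W.
Proof.
rewrite WE -[X in measurable X]setTI; apply: measurable_consR => //.
exact: measurable_covered.
Qed.

Let P : set (measurableTypeR R * d.-tuple (measurableTypeR R)) :=
  \bigcup_(c < N) (cell N c `*` covered (slice N c)).

Let mPc c : measurable (@cell R N c `*` covered (slice N c)).
Proof.
by have := measurableX (@measurable_cell R N c) (measurable_covered (slice N c)).
Qed.

Let mP : measurable P.
Proof. by apply: fin_bigcup_measurable => // i _; exact: mPc. Qed.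

Let N_gt0 : (0 < N)%N. Proof. by rewrite muln_gt0 M_gt0. Qed.

Let kleeW : klee_measure s = (lambda \x mu d)%E W.
Proof. by rewrite /klee_measure -coveredE WE. Qed.

Let measureP :
  ((lambda \x mu d) P = \sum_(c < N) (N%:R^-1)%:E * klee_measure (slice N c))%E.
Proof.
rewrite /P bigcup_mkord measure_bigsetU_ord//.
  apply: eq_bigr => c _; rewrite -(@measure_cell R N c)//.
  rewrite /klee_measure -coveredE; apply: product_measure1E.
    exact: measurable_cell.
  exact: measurable_covered.
move=> i j _ _ [[x z] [[/= xi _] [/= xj _]]].
exact/val_inj/(cell_uniq N_gt0 xi xj).
Qed.

Let PW : P `<=` W.
Proof.
move=> [x z] [c _ [/= cx]]; rewrite /covered/= /slice has_map.
move=> /hasP[r]; rewrite mem_filter => /andP[/andP[lc ch] rs] /= zr.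
apply/hasP; exists r => //; rewrite zr andbT.
move: cx; rewrite /cell/= in_itv/= => /andP[cx xc].
by rewrite (le_trans lc (ltW cx)) (le_trans xc ch).
Qed.

Let cube : set (d.-tuple (measurableTypeR R)) :=
  hyperrect_set (Hyperrect (fun=> 0) (fun=> 1)).

Let cube1 : mu d cube = 1%:E.
Proof.
rewrite lebesgue_tuple_hyperrect//= big1// => i _.
by rewrite subr0.
Qed.

(** Fixing [z] leaves the first sides of the rectangles whose tail contains [z], to which the
    estimate on the line applies. The indicator confines the bound to a set of volume 1. *)
Let lost_section z :
  (lambda (ysection (W `\` P) z) <= (2 / k%:R)%:E * (\1_cube z)%:E)%E.
Proof.
have [zc|zc] := pselect (cube z); last first.
  rewrite indicE memNset// mule0 (_ : ysection _ _ = set0) ?measure0//.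
  apply/seteqP; split=> // x; rewrite /ysection/= inE => -[].
  move=> /hasP[r rs /= /andP[_ /forallP zr]] _; apply: zc => i /=.
  have /andP[lz zh] := zr i; have [l0 h1 _] := sfat rs (lift ord0 i).
  by rewrite (le_trans l0 lz) (le_trans zh h1).
rewrite indicE mem_set// mule1.
apply: (@measure_straddling_cells _ _ [seq r <- s | rect_mem (rect_tail r) z]
  (fun r => low r ord0) (fun r => high r ord0) M) => //.
- move=> r; rewrite mem_filter => /andP[_ rs].
  by have [_ _] := sfat rs ord0; exact: le_trans.
- by apply: measurable_ysection; exact: measurableD.
- move=> x; rewrite /ysection/= inE => -[/hasP[r rs /= /andP[/andP[lx xh] _]] _].
  have [l0 h1 _] := sfat rs ord0; rewrite in_itv/=.
  by rewrite (le_trans l0 lx) (le_trans xh h1).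
- move=> x; rewrite /ysection/= inE => -[/hasP[r rs /= /andP[xr zr]] _].
  by apply/hasP; exists r => //; rewrite mem_filter zr.
move=> x c cN; rewrite /ysection/= inE => -[_ NP] cx.
apply/hasPn => r; rewrite mem_filter => /andP[zr rs]; apply/negP => cr.
apply: NP; exists c => //; split=> //=; rewrite /covered/= has_map.
by apply/hasP; exists r => //; rewrite mem_filter cr.
Qed.

(* The sections are taken at a fixed value of the other coordinates, hence the
   product measure integrated in the opposite order. *)
Let measure_lost : ((lambda \x mu d) (W `\` P) <= (2 / k%:R)%:E)%E.
Proof.
have mWP : measurable (W `\` P) by exact: measurableD.
have mcube : measurable cube by exact: measurable_hyperrect_set.
rewrite (@product_measure_unique _ _ _ _ _ _ _ (lambda \x^ mu d)%E)//; last first.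
  by move=> *; exact: product_measure2E.
have k2 : (0 <= (2 / k%:R)%:E :> \bar R)%E by rewrite lee_fin divr_ge0.
apply: (@le_trans _ _ (\int[mu d]_z ((2 / k%:R)%:E * (\1_cube z)%:E))%E).
  apply: ge0_le_integral => //=.
  - exact: measurable_fun_ysection.
  - by apply: measurable_funeM; exact/measurable_EFinP/measurable_indic.
rewrite ge0_integralZl//; last first.
  exact/measurable_EFinP/measurable_indic.
rewrite integral_indic// setIT.
by apply: (le_trans (y := (2 / k%:R)%:E * mu d cube)%E) => //; rewrite cube1 mule1.
Qed.

(** [W] splits into [P], a disjoint union of products over the cells, and a remainder of volume at
    most 2/k. *)
Lemma klee_slices :
  (\sum_(c < N) (N%:R^-1)%:E * klee_measure (slice N c) <= klee_measure s <=
   \sum_(c < N) (N%:R^-1)%:E * klee_measure (slice N c) + (2 / k%:R)%:E)%E.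
Proof.
rewrite kleeW -measureP; apply/andP; split.
  by apply: le_measure; rewrite ?inE.
have -> : ((lambda \x mu d) W = (lambda \x mu d) (W `\` P) + (lambda \x mu d) P)%E.
  rewrite -[in X in (_ + X)%E](setIidr PW); exact: measureDI.
by rewrite addeC leeD2l.
Qed.

End step.
End rectangles.

(** * Column volumes *)

Section columns.
Context (R : realType).
Notation lambda := (@lebesgue_measure R).

(** [lift ord_max] enumerates all coordinates but the last, which is kept exact. *)
Definition spans m N (c : m.-tuple 'I_N) (r : hyperrect R m.+1) : bool :=
  [forall i : 'I_m, (low r (lift ord_max i) <= (tnth c i)%:R / N%:R) &&
                    ((tnth c i).+1%:R / N%:R <= high r (lift ord_max i))].

Definition column m N (c : m.-tuple 'I_N) (s : seq (hyperrect R m.+1)) :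
    set (measurableTypeR R) :=
  [set t | has (fun r => spans c r && (low r ord_max <= t <= high r ord_max)) s].

Definition columns_volume m N (s : seq (hyperrect R m.+1)) : \bar R :=
  (\sum_(c : m.-tuple 'I_N) (N%:R^-1 ^+ m)%:E * lambda (column c s))%E.

Lemma spans_cons m N (a : 'I_N) (c : m.-tuple 'I_N) (r : hyperrect R m.+2) :
  spans [tuple of a :: c] r =
  (low r ord0 <= a%:R / N%:R) && (a.+1%:R / N%:R <= high r ord0) &&
  spans c (rect_tail r).
Proof.
have lift00 : lift ord_max ord0 = ord0 :> 'I_m.+2 by exact: val_inj.
have liftS (i : 'I_m) :
    lift ord_max (lift ord0 i) = lift ord0 (lift ord_max i) :> 'I_m.+2.
  by apply: val_inj; rewrite [LHS]lift_max [LHS]lift0 [RHS]lift0 lift_max.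
apply/forallP/andP => [ar|[r0 /forallP cr] i].
  split; first by have := ar ord0; rewrite tnth0 lift00.
  by apply/forallP => i; have := ar (lift ord0 i); rewrite tnthS liftS.
case: (unliftP ord0 i) => [j|] ->; rewrite ?tnthS ?liftS ?tnth0 ?lift00//.
exact: cr.
Qed.

Lemma column_cons m N (a : 'I_N) (c : m.-tuple 'I_N) (s : seq (hyperrect R m.+2)) :
  column [tuple of a :: c] s = column c (slice s N a).
Proof.
have lift_max : lift ord0 ord_max = ord_max :> 'I_m.+2 by exact: val_inj.
apply/funext => t; congr (is_true _); rewrite /slice has_map.
elim: s => //= r s ->; rewrite spans_cons.
by case: ifP => //= _; rewrite lift_max.
Qed.

(** Splitting off the first index of a column lets the induction peel coordinates in the order in
    which the measure is built. *)
Lemma columns_volume_slices m N (s : seq (hyperrect R m.+2)) :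
  (columns_volume N s =
   \sum_(a < N) (N%:R^-1)%:E * columns_volume N (slice s N a))%E.
Proof.
rewrite /columns_volume.
transitivity (\sum_(a < N) \sum_(c : m.-tuple 'I_N) (N%:R^-1)%:E *
    ((N%:R^-1 ^+ m)%:E * lambda (column c (slice s N a))))%E; last first.
  apply: eq_bigr => a _; rewrite ge0_sume_distrr// => c _.
  by rewrite mule_ge0// lee_fin exprn_ge0// invr_ge0.
rewrite pair_big/=.
rewrite (reindex (fun ac : 'I_N * m.-tuple 'I_N => [tuple of ac.1 :: ac.2]))/=.
  apply: eq_bigr => -[a c] _ /=.
  by rewrite column_cons exprS EFinM muleA.
exists (fun t => (thead t, [tuple of behead t])) => [[a c] _|t _] /=.
  by congr (_, _); exact: val_inj.
by rewrite [RHS]tuple_eta; exact: val_inj.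
Qed.

(** Base of the induction: in dimension one nothing is rounded, and the empty tuple is the only
    column. *)
Lemma klee_interval N (s : seq (hyperrect R 1)) :
  klee_measure s = columns_volume N s.
Proof.
rewrite /columns_volume (big_pred1 [tuple]); last first.
  by move=> c; rewrite [c]tuple0 /= eqxx.
rewrite expr0 mul1e /klee_measure -coveredE /= /lebesgue_cons /pushforward.
rewrite (_ : _ @^-1` _ = @column 0 N [tuple] s `*` setT).
  rewrite product_measure1E//.
    by rewrite [X in (_ * X)%E]diracT mule1.
  exact: measurable_has_itv.
have ord1 : ord_max = ord0 :> 'I_1 by exact: val_inj.
apply/seteqP; split => -[x z]; rewrite /column /covered /preimage /mkset => xz.
  split=> //; move: xz; congr (is_true _); apply: eq_has => r.
  rewrite rect_mem_cons ord1 /rect_mem /spans.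
  by rewrite !(introT forallP) ?andbT// => -[].
case: xz => + _; congr (is_true _); apply: eq_has => r.
rewrite rect_mem_cons ord1 /rect_mem /spans.
by rewrite !(introT forallP) ?andbT// => -[].
Qed.

Lemma klee_columns (delta : R) M k m (s : seq (hyperrect R m.+1)) :
  (0 < M)%N -> (0 < k)%N -> M%:R^-1 <= delta ->
  (forall r, r \in s -> fat_in_unit_cube delta r) ->
  (columns_volume (M * k) s <= klee_measure s <=
   columns_volume (M * k) s + (m%:R * (2 / k%:R))%:E)%E.
Proof.
move=> M0 k0 Md; elim: m s => [|m IHm] s sfat.
  by rewrite -klee_interval mul0r adde0 lexx.
have N0 : (0 < M * k)%N by rewrite muln_gt0 M0.
have slice_fat a r : r \in slice s (M * k) a -> fat_in_unit_cube delta r.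
  move=> /mapP[r']; rewrite mem_filter => /andP[_ r's] ->.
  exact/fat_rect_tail/sfat.
have IHs a := IHm _ (@slice_fat a).
have iN0 : (0 <= ((M * k)%:R^-1 : R)%:E)%E by rewrite lee_fin invr_ge0.
have /andP[lo hi] := klee_slices M0 k0 Md sfat.
rewrite columns_volume_slices; apply/andP; split.
  apply: le_trans lo; apply: lee_sum => a _; apply: lee_wpmul2l => //.
  by have /andP[] := IHs a.
have -> : m.+1%:R * (2 / k%:R) = m%:R * (2 / k%:R) + 2 / k%:R :> R.
  by rewrite -natr1 mulrDl mul1r.
apply: (le_trans hi); rewrite EFinD addeA; apply: leeD2r.
apply: (@le_trans _ _ (\sum_(a < M * k) (((M * k)%:R^-1)%:E *
    columns_volume (M * k) (slice s (M * k) a) +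
    ((M * k)%:R^-1 * (m%:R * (2 / k%:R)))%:E))%E).
  apply: lee_sum => a _; rewrite EFinM -ge0_muleDr ?lee_fin//.
  - by apply: lee_wpmul2l => //; have /andP[] := IHs a.
  - by apply: sume_ge0 => c _; apply: mule_ge0; rewrite ?lee_fin.
(* With N cells of weight 1/N, the errors of the slices average to m * 2/k instead of adding up. *)
rewrite big_split/= leeD2l// sumEFin lee_fin sumr_const card_ord.
by rewrite -[leLHS]mulr_natl mulVKf// gt_eqF ?ltr0n.
Qed.

End columns.

(** * The streaming algorithm *)

Section terms.
Context (R : realType) (X A : Type).
Implicit Types (env : X -> R) (t : term X).

Definition ratio (a b : nat) : term X := Div (Nat a) (Nat b).

Definition max_term t1 t2 : term X := IfLe t1 t2 t2 t1.

Definition min_term t1 t2 : term X := IfLe t1 t2 t1 t2.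

Definition sum_term (ts : seq (term X)) : term X :=
  foldr (fun t1 t2 => Add t1 t2) (Nat 0) ts.

Definition guard (tests : seq (term X * term X)) (yes no : decision_tree X A) :=
  foldr (fun test tree => TestLe test.1 test.2 tree no) yes tests.

Lemma eval_sum_term env ts :
  Defs.eval env (sum_term ts) = \sum_(t <- ts) Defs.eval env t.
Proof. by elim: ts => [|t ts IHts] /=; rewrite ?big_nil// big_cons IHts. Qed.

Lemma decide_guard env tests yes no :
  decide env (guard tests yes no) =
  if all (fun test => Defs.eval env test.1 <= Defs.eval env test.2) tests
  then decide env yes else decide env no.
Proof. by elim: tests => //= t tests ->; case: ifP. Qed.

End terms.

Lemma all_flatten (T : Type) (P : pred T) (ss : seq (seq T)) :
  all P (flatten ss) = all (all P) ss.
Proof. by elim: ss => //= s ss IHss; rewrite all_cat IHss. Qed.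

(** The algorithm tests spanning and anchoring together, whereas the interval lemmas concern the
    sublist spanning a column. *)
Lemma running_max_filter (R : realType) (T : Type) (P Q : pred T) (f : T -> R)
    (m0 : R) (s : seq T) :
  running_max P f m0 [seq r <- s | Q r] =
  running_max (fun r => Q r && P r) f m0 s.
Proof.
rewrite /running_max; elim: s m0 => //= r s IHs m0.
by case: (Q r) => /=; exact: IHs.
Qed.

Lemma running_min_filter (R : realType) (T : Type) (P Q : pred T) (f : T -> R)
    (m0 : R) (s : seq T) :
  running_min P f m0 [seq r <- s | Q r] =
  running_min (fun r => Q r && P r) f m0 s.
Proof.
rewrite /running_min; elim: s m0 => //= r s IHs m0.
by case: (Q r) => /=; exact: IHs.
Qed.

(** * The grid algorithm and its exact answer *)

Section grid_algorithm.
Context (R : realType) (m M N : nat).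

(** One stored number per column, block and direction; [true] marks the lowest point reached from
    above, [false] the highest from below. *)
Definition slot : finType := (m.-tuple 'I_N * 'I_M * bool)%type.

Let d := m.+1.
Let p := #|{: slot}|.
Let var := update_var d p 0.
Let last : 'I_d := ord_max.

Definition span_tests (c : m.-tuple 'I_N) : seq (term var * term var) :=
  flatten [seq
    [:: (Var (LowVar (lift ord_max i)), ratio _ (tnth c i) N);
        (ratio _ (tnth c i).+1 N, Var (HighVar (lift ord_max i)))]
  | i <- enum 'I_m].

(** The final comparison with the stored number makes the tests agree with the update condition of
    [running_max] or [running_min]. *)
Definition slot_tests (q : 'I_p) : seq (term var * term var) :=
  let: (c, j, down) := enum_val q in
  let stored := Var (SketchVar (PointVar q ord0)) in
  span_tests c ++
  if down then [:: (ratio _ j.+1 M, Var (HighVar last));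
                   (Var (LowVar last), stored)]
  else [:: (Var (LowVar last), ratio _ j M);
           (stored, Var (HighVar last))].

Definition block_term (cj : m.-tuple 'I_N * 'I_M) : term (sketch_var d p 0) :=
  let lower := ratio _ cj.2 M in
  let upper := ratio _ cj.2.+1 M in
  let up := Var (PointVar (enum_rank ((cj, false) : slot)) ord0) in
  let down := Var (PointVar (enum_rank ((cj, true) : slot)) ord0) in
  Defs.Sub (ratio _ 1 M)
    (max_term (Nat 0) (Defs.Sub (min_term down upper) (max_term up lower))).

(** All coordinates of a point word carry the same number, read at [ord0]. The initial values 0 and
    1 are those of [reach_up] and [reach_down]; the final division applies the common weight of the
    columns. *)
Definition grid_algorithm : algorithm d := @Algorithm d p 0
  (fun q _ => if (enum_val q).2 then Init1 else Init0)
  (fun q => guard (slot_tests q)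
     (Leaf (fun=> if (enum_val q).2 then FromLow last else FromHigh last))
     (Leaf (fun i => FromPoint q i)))
  (fun=> Leaf Reset)
  (Div (sum_term [seq block_term cj | cj <- enum {: m.-tuple 'I_N * 'I_M}])
       (Nat (N ^ m))).

Lemma space_grid_algorithm :
  space_in_words grid_algorithm = (N ^ m * M * 2 + 3)%N.
Proof.
by rewrite /space_in_words /= addn0 /p !card_prod card_tuple !card_ord card_bool.
Qed.

Context (delta eps : R).
Notation sketchA := (sketch R d p 0).

Lemma all_span_tests (mem : sketchA) r (c : m.-tuple 'I_N) :
  all (fun t => Defs.eval (@update_env R d grid_algorithm delta eps mem r) t.1 <=
                Defs.eval (@update_env R d grid_algorithm delta eps mem r) t.2)
    (span_tests c) = spans c r.
Proof.
rewrite /span_tests all_flatten all_map /spans.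
apply/allP/forallP => cr i; first by have := cr i (mem_enum _ _); rewrite /= andbT.
by move=> _; rewrite /= andbT; exact: cr.
Qed.

Lemma run_up (mem : sketchA) s (cj : m.-tuple 'I_N * 'I_M) :
  let q := enum_rank ((cj, false) : slot) in
  point_word (foldl (@step R d grid_algorithm delta eps) mem s) q ord0 =
  running_max (fun r => spans cj.1 r && (low r ord_max <= cj.2%:R / M%:R))
    (fun r => high r ord_max) (point_word mem q ord0) s.
Proof.
move=> q; elim: s mem => //= r s IHs mem.
rewrite IHs /running_max /=; congr foldl.
rewrite decide_guard /slot_tests enum_rankK; case: cj @q IHs => c j q IHs /=.
rewrite all_cat all_span_tests/= andbT andbA.
by case: ifP.
Qed.

Lemma run_down (mem : sketchA) s (cj : m.-tuple 'I_N * 'I_M) :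
  let q := enum_rank ((cj, true) : slot) in
  point_word (foldl (@step R d grid_algorithm delta eps) mem s) q ord0 =
  running_min (fun r => spans cj.1 r && (cj.2.+1%:R / M%:R <= high r ord_max))
    (fun r => low r ord_max) (point_word mem q ord0) s.
Proof.
move=> q; elim: s mem => //= r s IHs mem.
rewrite IHs /running_min /=; congr foldl.
rewrite decide_guard /slot_tests enum_rankK; case: cj @q IHs => c j q IHs /=.
rewrite all_cat all_span_tests/= andbT andbA.
by case: ifP.
Qed.

Hypotheses (M_gt0 : (0 < M)%N) (Mdelta : M%:R^-1 <= delta).

(** The stored reaches determine the measure of every column exactly, so rounding is the only source
    of error. *)
Lemma answer_grid_algorithm (s : seq (hyperrect R m.+1)) :
  (forall r, r \in s -> fat_in_unit_cube delta r) ->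
  (answer grid_algorithm delta eps s)%:E = columns_volume N s.
Proof.
move=> sfat.
pose sc (c : m.-tuple 'I_N) := [seq r <- s | spans c r].
pose lo (r : hyperrect R d) := low r ord_max.
pose hi (r : hyperrect R d) := high r ord_max.
pose F (c : m.-tuple 'I_N) (j : 'I_M) :=
  block_length M (reach_up (sc c) lo hi M j) (reach_down (sc c) lo hi M j) j.
have blockE (cj : m.-tuple 'I_N * 'I_M) :
    Defs.eval (@sketch_env R d grid_algorithm delta eps
                 (run grid_algorithm delta eps s)) (block_term cj) =
    F cj.1 cj.2.
  rewrite /block_term [LHS]/= mul1r.
  rewrite -!minEle -!maxEle run_up run_down /= !enum_rankK/=.
  rewrite /F /block_length /reach_up /reach_down.
  by rewrite running_max_filter running_min_filter.
rewrite /answer /= eval_sum_term big_map big_enum/=.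
rewrite (eq_bigr (fun cj : m.-tuple 'I_N * 'I_M => F cj.1 cj.2)); last first.
  by move=> cj _; exact: blockE.
rewrite -(pair_bigA _ F) /columns_volume mulr_suml -sumEFin.
apply: eq_bigr => c _.
have -> : column c s = [set t | has (fun r => lo r <= t <= hi r) (sc c)].
  apply/funext => t; congr (is_true _); rewrite /sc.
  by elim: s {sfat sc F blockE} => //= r s' ->; case: ifP.
rewrite (measure_has_itv M_gt0); first last.
- by move=> r; rewrite mem_filter => /andP[_ /sfat/(_ ord_max)[]].
- move=> r; rewrite mem_filter => /andP[_ /sfat/(_ ord_max)[_ _]].
  exact: le_trans.
by rewrite -EFinM mulrC natrX exprVn.
Qed.

End grid_algorithm.

(** * Grid size and space bound *)

Section parameters.
Context (R : realType).

Definition block_count (delta : R) : nat := (Num.truncn delta^-1).+1.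

(** Chosen so that [m] roundings, each losing at most 2/k, lose at most [eps] together. *)
Definition refinement (m : nat) (eps : R) : nat :=
  (Num.truncn (2 * m%:R / eps)).+1.

Definition klee_algorithm (d : nat) (delta eps : R) : algorithm d :=
  if d is m.+1 then
    let M := block_count delta in grid_algorithm m M (M * refinement m eps)
  else @Algorithm 0 0 0 (fun=> fun=> Init0) (fun=> Leaf (fun=> FromInitial Init0))
    (fun=> Leaf Reset) (Nat 0).

Lemma block_count_inv (delta : R) : 0 < delta -> (block_count delta)%:R^-1 <= delta.
Proof.
move=> delta0; rewrite invf_ple ?posrE ?ltr0n//; exact/ltW/truncnS_gt.
Qed.

Lemma block_count_le (delta : R) :
  0 < delta < 1 -> (block_count delta)%:R <= 2 / delta.
Proof.
move=> /andP[delta0 delta1].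
have i1 : 1 <= delta^-1 by rewrite invf_ge1// ltW.
rewrite /block_count -natr1 mulrDl mul1r lerD// truncn_le//.
by rewrite invr_ge0 ltW.
Qed.

Lemma refinement_error m (eps : R) :
  0 < eps -> m%:R * (2 / (refinement m eps)%:R) <= eps.
Proof.
move=> eps0; rewrite mulrCA mulrA ler_pdivrMr ?ltr0n// -ler_pdivrMl//.
by rewrite mulrC; exact/ltW/truncnS_gt.
Qed.

(** Since 1 <= 1/eps, the successor is absorbed into (2m + 1)/eps, and 2m + 1 <= 2^(m+1). *)
Lemma refinement_le m (eps : R) :
  0 < eps < 1 -> (refinement m eps)%:R <= 2 ^+ m.+1 / eps.
Proof.
move=> /andP[eps0 eps1].
have i1 : 1 <= eps^-1 by rewrite invf_ge1// ltW.
have x0 : 0 <= 2 * m%:R / eps by rewrite divr_ge0 ?mulr_ge0// ltW.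
rewrite /refinement -[leLHS]natr1; apply: (@le_trans _ _ ((2 * m)%N.+1%:R / eps)).
  by rewrite -[(2 * m)%N.+1%:R]natr1 [leRHS]mulrDl mul1r natrM lerD// truncn_le.
rewrite ler_pM2r ?invr_gt0// -natrX ler_nat expnS mul2n -addnn.
have := ltn_expl m (ltnSn 1); lia.
Qed.

Lemma space_klee_algorithm m (delta eps : R) :
  0 < delta < 1 -> 0 < eps < 1 ->
  (space_in_words (klee_algorithm m.+1 delta eps))%:R
    <= 5 * (2 ^+ (m.+1 ^ 2 + m.+1) / (eps ^+ (m.+1 - 1) * delta ^+ m.+1)) :> R.
Proof.
move=> delta01 eps01; rewrite space_grid_algorithm subn1 /=.
have Mle := block_count_le delta01; have kle := refinement_le m eps01.
case/andP: delta01 => delta0 delta1; case/andP: eps01 => eps0 eps1.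
set M := block_count delta in Mle *; set k := refinement m eps in kle *.
set B := _ / _.
(* This charges the three parameter words to [B]; with two numbers per column and block the total is
   2B + 3B = 5B. *)
have B1 : 1 <= B.
  rewrite /B ler_pdivlMr ?mulr_gt0 ?exprn_gt0// mul1r.
  apply: (@le_trans _ _ 1); last by rewrite -natrX ler1n expn_gt0.
  by rewrite mulr_ile1 ?exprn_ge0 ?exprn_ile1 ?ltW.
(* With d = m + 1, the power of 2 that arises is d + d(d - 1) = d^2, within d^2 + d. *)
have cells : ((M * k) ^ m * M)%:R <= B.
  rewrite expnMn mulnAC -expnSr natrM !natrX.
  apply: (@le_trans _ _ ((2 / delta) ^+ m.+1 * (2 ^+ m.+1 / eps) ^+ m)).
    by apply: ler_pM; rewrite ?exprn_ge0// lerXn2r// nnegrE ?divr_ge0 ?exprn_ge0// ltW.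
  rewrite !expr_div_n -exprM mulf_div -exprD [X in _ / X]mulrC /B.
  rewrite ler_pM2r ?invr_gt0 ?mulr_gt0 ?exprn_gt0//.
  rewrite -!natrX ler_nat leq_exp2l//; nia.
by rewrite natrD natrM; lra.
Qed.

End parameters.

Theorem theorem6 (R : realType) :
  exists (A : forall d : nat, R -> R -> algorithm d) (C : R), 0 < C /\
    forall (d : nat) (delta eps : R),
      (0 < d)%N -> 0 < delta < 1 -> 0 < eps < 1 ->
      (space_in_words (A d delta eps))%:R
        <= C * (2 ^+ (d ^ 2 + d) / (eps ^+ (d - 1) * delta ^+ d)) /\
      forall (n : nat) (s : n.-tuple (hyperrect R d)),
        (forall i : 'I_n, fat_in_unit_cube delta (tnth s i)) ->
        counters_fit (A d delta eps) delta eps s /\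
        (klee_measure s - eps%:E
           <= (answer (A d delta eps) delta eps s)%:E
           <= klee_measure s)%E.
Proof.
exists (@klee_algorithm R), 5; split=> // -[//|m] delta eps _ delta01 eps01.
split=> [|n s sfat]; first exact: space_klee_algorithm.
(* There are no counter words, so they all fit. *)
split=> [t []//|].
have {}sfat r : r \in (s : seq _) -> fat_in_unit_cube delta r.
  by move=> /tnthP[i ->]; exact: sfat.
case/andP: delta01 eps01 => delta0 _ /andP[eps0 _].
have Mdelta := block_count_inv delta0.
rewrite [X in (_ <= X <= _)%E](answer_grid_algorithm _ _ _ Mdelta)//.
have k0 : (0 < refinement m eps)%N by [].
have M0 : (0 < block_count delta)%N by [].
have /andP[lo hi] := klee_columns M0 k0 Mdelta sfat.
rewrite lo andbT leeBlDr//; apply: (le_trans hi).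
by rewrite leeD2l// lee_fin refinement_error.
Qed.
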